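(* Let $G\in\mathcal{G}$, with cliques on $X=\{x_1,\ldots,x_m\}$ and $Y=\{y_1,\ldots,y_n\}$, where $n\geq m+2$, such that $\{x_1,y_1\}$, $\{x_1,y_2\}$, $\{x_2,y_2\}$ are edges of $G$ and at most $n-m$ vertices of $Y$ have a neighbour in $X$. Then $T_2(G)$ is not well-covered.
   Context: $\mathcal{G}$ is the class of graphs obtained by taking the disjoint union of a complete graph $K_m$ with vertex set $X=\{x_1,\ldots,x_m\}$ and a complete graph $K_n$ with vertex set $Y=\{y_1,\ldots,y_n\}$, where $n\geq m$, and then adding some (possibly no) edges each joining a vertex of $X$ to a vertex of $Y$. The $2$-token graph $T_2(G)$ has as vertices the $2$-subsets of $V(G)$, two of them adjacent if their symmetric difference is an edge of $G$. A graph is well-covered if all of its maximal (with respect to inclusion) independent sets have the same cardinality. *)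

(* Defs.v *)
From HB Require Import structures.
From mathcomp Require Import all_boot.

Set Implicit Arguments.
Unset Strict Implicit.
Unset Printing Implicit Defensive.

Record sgraph := SGraph {
  vertex :> finType;
  adj : rel vertex;
  adj_sym : symmetric adj;
  adj_irr : irreflexive adj
}.

Definition edges (G : sgraph) : {set {set G}} :=
  [set [set p.1; p.2] | p in [set p : G * G | adj p.1 p.2]].

Definition symdiff (T : finType) (A B : {set T}) : {set T} :=
  (A :\: B) :|: (B :\: A).

Lemma symdiffC (T : finType) (A B : {set T}) : symdiff A B = symdiff B A.
Proof. by rewrite /symdiff setUC. Qed.

Definition token2_vertex (G : sgraph) : finType :=
  {A : {set G} | #|A| == 2}.

Definition token2_adj (G : sgraph) : rel (token2_vertex G) :=
  fun A B => symdiff (val A) (val B) \in edges G.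

Lemma token2_adj_sym (G : sgraph) : symmetric (@token2_adj G).
Proof. by move=> A B; rewrite /token2_adj symdiffC. Qed.

Lemma token2_adj_irr (G : sgraph) : irreflexive (@token2_adj G).
Proof.
move=> A; rewrite /token2_adj /symdiff setDv setU0.
apply/negP => /imsetP [p _] /setP /(_ p.1).
by rewrite !inE eqxx.
Qed.

Definition token2 (G : sgraph) : sgraph :=
  SGraph (@token2_adj_sym G) (@token2_adj_irr G).

Definition independent (G : sgraph) (S : {set G}) : bool :=
  [forall u in S, forall v in S, ~~ adj u v].

Definition well_covered (G : sgraph) : Prop :=
  forall S1 S2 : {set G},
    maxset (@independent G) S1 -> maxset (@independent G) S2 -> #|S1| = #|S2|.

Definition clique (G : sgraph) (S : {set G}) : Prop :=
  {in S &, forall u v, u != v -> adj u v}.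

(* G lies in the class, with m = #|X| and n = #|Y|; the edges between X and Y
   are unconstrained. *)
Definition two_clique_graph (G : sgraph) (X Y : {set G}) : Prop :=
  [/\ X :|: Y = [set: G], [disjoint X & Y], clique X, clique Y & #|X| <= #|Y| ].

(* Main.v *)
Require Import Defs.
From HB Require Import structures.
From mathcomp Require Import all_boot.
From mathcomp Require Import zify.

(** An independent set of [T_2(G)] is a union of three matchings: one inside [X],
    one inside [Y] and one between [X] and [Y], subject to the condition that
    [{w,a}] and [{w,b}] never occur together when [ab] is an edge.  So its size
    is at most [m/2 + m + n/2] (with floors).  Since at least [m] vertices of [Y]
    have no neighbour in [X], matching [X] into them comes (almost) for free, and
    this bound is attained, except possibly for one lost pair inside [Y].
    On the other hand a few pairs [{x,y}] can forbid all the pairs inside a small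
    [W] contained in [Y]; completing them by a perfect matching of [Y \ W] makes
    every maximal extension smaller.  One takes [W = {y1,y2}] for [n] even and
    [W = {y1,y2,z}], with [z] having no neighbour in [X], for [n] odd; if one pair
    is lost in the large set then every vertex of [X] is joined to every vertex
    of [Y] having a neighbour in [X], and [W] can be chosen with four elements. *)

Set Implicit Arguments.
Unset Strict Implicit.
Unset Printing Implicit Defensive.

(** * Families of pairs and matchings *)

(** Stated for sets of vertices of [G], so that families can be built without the subtype
    [token2_vertex]. The case [a = b] is harmless because [adj] is irreflexive. *)
Definition token_independent (G : sgraph) (F : {set {set G}}) : Prop :=
  {in F, forall B : {set G}, #|B| = 2} /\
  forall w a b : G, [set w; a] \in F -> [set w; b] \in F -> ~~ adj a b.

(** These are the matchings, perfect or not, of the complete graph on [A]. *)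
Definition matching_on (T : finType) (A : {set T}) (M : {set {set T}}) : Prop :=
  {in M, forall B : {set T}, B \subset A /\ #|B| = 2} /\ trivIset M.

Lemma set2_of_mem (T : finType) (B : {set T}) (w : T) :
  #|B| = 2 -> w \in B -> exists2 a, a != w & B = [set w; a].
Proof.
move=> /eqP /cards2P [u [v [uv ->]]]; rewrite !inE => /orP[] /eqP ->.
  by exists v; rewrite // eq_sym.
by exists u; rewrite // setUC.
Qed.

Lemma card_set2_neq (T : finType) (a b : T) : #|[set a; b]| = 2 -> a != b.
Proof. by rewrite cards2; case: (a != b). Qed.

Lemma matching_eq (T : finType) (M : {set {set T}}) (w a b : T) :
  {in M, forall B : {set T}, #|B| = 2} -> trivIset M ->
  [set w; a] \in M -> [set w; b] \in M -> a = b.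
Proof.
move=> M2 tM wa wb.
have eq_ab : [set w; a] = [set w; b].
  apply/eqP; apply: contraT => /(trivIsetP tM _ _ wa wb) /pred0P /(_ w).
  by rewrite /= !inE eqxx.
have /card_set2_neq wna := M2 _ wa.
by move/setP/(_ a): eq_ab; rewrite !inE eqxx orbT eq_sym (negPf wna) => /esym /eqP.
Qed.

Lemma card_cover_matching (T : finType) (A : {set T}) (M : {set {set T}}) :
  matching_on A M -> cover M \subset A /\ #|cover M| = #|M| * 2.
Proof.
move=> [M2 tM]; split; first by apply/bigcupsP => B /M2 [].
apply: card_uniform_partition => [B /M2 [] //|].
rewrite /partition eqxx tM /=.
by apply/negP => /M2 []; rewrite cards0.
Qed.

Lemma matching_on_setU {T : finType} {A A' : {set T}} {M M' : {set {set T}}} :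
  matching_on A M -> matching_on A' M' -> [disjoint A & A'] ->
  matching_on (A :|: A') (M :|: M') /\ #|M :|: M'| = #|M| + #|M'|.
Proof.
move=> [M2 tM] [M2' tM'] dA.
have dMM (B B' : {set T}) : B \in M -> B' \in M' -> [disjoint B & B'].
  move=> /M2 [sB _] /M2' [sB' _].
  exact: disjointWl sB (disjointWr sB' dA).
split; [split|].
- move=> B; rewrite inE => /orP[/M2|/M2'] [sB ->]; split => //.
    exact: subset_trans sB (subsetUl _ _).
  exact: subset_trans sB (subsetUr _ _).
- apply/trivIsetP => B B'; rewrite !inE => /orP[] hB /orP[] hB' neq.
  + exact: (trivIsetP tM).
  + exact: dMM.
  + by rewrite disjoint_sym; apply: dMM.
  + exact: (trivIsetP tM').
- rewrite cardsU [X in _ - X](_ : _ = 0) ?subn0 //; apply/eqP; rewrite cards_eq0.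
  apply/eqP/setP => B; rewrite !inE; apply/negP => /andP[hB hB'].
  have := dMM B B hB hB'; rewrite -setI_eq0 setIid => /eqP B0.
  by have [_] := M2 _ hB; rewrite B0 cards0.
Qed.

Lemma matching_on_pair (T : finType) (a b : T) :
  a != b -> matching_on [set a; b] [set [set a; b]].
Proof.
move=> ab; split=> [B|]; last first.
  by apply/trivIsetP => B B' /set1P -> /set1P ->; rewrite eqxx.
by move/set1P ->; rewrite cards2 ab subxx.
Qed.

Lemma exists_matching (T : finType) (A : {set T}) :
  exists2 M, matching_on A M & #|M| = #|A|./2.
Proof.
have [k] := ubnP #|A|; elim: k A => // k IH A ltA.
have [A1|A1] := leqP #|A| 1.
  exists set0; last by rewrite cards0; lia.
  by split=> [B|]; [rewrite inE | apply/trivIsetP => B B'; rewrite inE].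
have [a [b [aA bA ab]]] := card_gt1P A1.
have sab : [set a; b] \subset A by apply/subsetP => c /set2P [] ->.
have cD : #|A :\: [set a; b]| = #|A| - 2.
  by rewrite cardsD (setIidPr sab) cards2 ab.
have [|M hM cM] := IH (A :\: [set a; b]); first by lia.
have dab : [disjoint [set a; b] & A :\: [set a; b]].
  by rewrite -setI_eq0 setIDA setIC -setIDA setDv setI0.
have [hU cU] := matching_on_setU (matching_on_pair ab) hM dab.
exists ([set [set a; b]] :|: M); first by move: hU; rewrite setDE setUIr setUCr setIT (setUidPr sab).
by rewrite cU cards1 cM cD; lia.
Qed.

(** The i-th element of [enum A] is sent to the i-th element of [enum B]; on [A] the default value
    of [nth] is never reached. *)
Lemma exists_injection (T : finType) (A B : {set T}) : #|A| <= #|B| ->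
  exists2 f : T -> T, {in A &, injective f} & {in A, forall x, f x \in B}.
Proof.
move=> leAB.
have idx x : x \in A -> index x (enum A) < size (enum B).
  by move=> xA; rewrite -cardE; apply: leq_trans leAB; rewrite cardE index_mem mem_enum.
exists (fun x => nth x (enum B) (index x (enum A))).
  move=> x y xA yA; rewrite (set_nth_default y x) ?idx // => /eqP.
  rewrite nth_uniq ?idx ?enum_uniq // => /eqP eqi.
  by rewrite -(nth_index x (s := enum A) (x := x)) ?mem_enum // eqi nth_index ?mem_enum.
by move=> x xA; rewrite -mem_enum mem_nth ?idx.
Qed.

(** * Independent sets of the token graph as families of pairs *)

(** Since the symmetric difference has 4 - 2|A ∩ B| elements and an edge has 2, adjacent pairs share
    exactly one vertex [w]. *)
Lemma token2_adjP (G : sgraph) (A B : {set G}) : #|A| = 2 -> #|B| = 2 ->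
  reflect (exists w a b, [/\ A = [set w; a], B = [set w; b] & adj a b])
          (symdiff A B \in edges G).
Proof.
move=> A2 B2; apply: (iffP idP) => [|[w [a [b [eA eB ab]]]]].
  move/imsetP => [[a b]]; rewrite inE /= => ab eD.
  have anb : a != b by apply: contraTneq ab => ->; rewrite adj_irr.
  have cAB : #|A :&: B| = 1.
    have : #|symdiff A B| = 2 by rewrite eD cards2 anb.
    rewrite /symdiff cardsU [X in _ - X](_ : _ = 0); last first.
      apply/eqP; rewrite cards_eq0; apply/eqP/setP => c; rewrite !inE.
      by case: (c \in A); case: (c \in B).
    by rewrite !cardsD A2 B2 [B :&: A]setIC; lia.
  have /cards1P [w ew] : #|A :&: B| == 1 by rewrite cAB.
  have : w \in A :&: B by rewrite ew set11.
  rewrite inE => /andP[wA wB].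
  have [u uw eA] := set2_of_mem A2 wA; have [v vw eB] := set2_of_mem B2 wB.
  have uv : u != v.
    by apply/eqP => uv; move: cAB; rewrite eA eB uv setIid cards2 eq_sym vw.
  (* The sets {a, b} and {u, v} coincide, but the ends may be swapped; hence the two cases below. *)
  have inD c : (c \in [set a; b]) = (c == u) || (c == v).
    rewrite -eD /symdiff eA eB !inE.
    have [->|cw] := eqVneq c w; first by rewrite !(eq_sym w) (negPf uw) (negPf vw).
    by have [->|_] := eqVneq c u; rewrite ?uv //=; case: (c == v).
  have := inD a; have := inD b; rewrite !inE !eqxx orbT /=.
  move=> /esym /orP[] /eqP eb /esym /orP[] /eqP ea;
    rewrite ea eb ?eqxx // in ab anb.
  - by exists w, u, v; rewrite adj_sym.
  - by exists w, u, v.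
have wa : w != a by apply: card_set2_neq; rewrite -eA.
have wb : w != b by apply: card_set2_neq; rewrite -eB.
have nab : a != b by apply: contraTneq ab => ->; rewrite adj_irr.
apply/imsetP; exists (a, b); rewrite ?inE //= /symdiff eA eB.
apply/setP => c; rewrite !inE.
have [->|] := eqVneq c w; first by rewrite (negPf wa) (negPf wb).
have [->|] := eqVneq c a; first by rewrite (negPf nab).
by case: (c == b).
Qed.

Lemma card_token2_vertex (G : sgraph) (A : token2_vertex G) : #|val A| = 2.
Proof. exact: (eqP (valP A)). Qed.

Lemma independent_token2P (G : sgraph) (S : {set token2 G}) :
  reflect (token_independent (val @: S)) (independent S).
Proof.
apply: (iffP forall_inP) => [indS|[_ indF] A AS].
  split=> [B /imsetP [A _ ->]|w a b]; first exact: card_token2_vertex.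
  move=> /imsetP [A AS eA] /imsetP [B BS eB].
  have /forall_inP /(_ B BS) := indS A AS.
  apply: contra => ab.
  apply/(token2_adjP (card_token2_vertex A) (card_token2_vertex B)).
  by exists w, a, b.
apply/forall_inP => B BS; apply/negP.
move=> /(token2_adjP (card_token2_vertex A) (card_token2_vertex B)) [w [a [b [eA eB]]]].
by apply/negP/(indF w); rewrite -?eA -?eB imset_f.
Qed.

(** Both families extend to maximal independent sets, which have equal size; the bound [k] holds for
    the one containing [F0], hence for the one containing [F1]. *)
Lemma well_covered_token2_leq (G : sgraph) (F0 F1 : {set {set G}}) (k : nat) :
  well_covered (token2 G) -> token_independent F0 -> token_independent F1 ->
  (forall F, token_independent F -> F0 \subset F -> #|F| <= k) -> #|F1| <= k.
Proof.
move=> wc i0 i1 le_k.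
have lift F : token_independent F -> exists2 S : {set token2 G},
    maxset (@independent (token2 G)) S & F \subset val @: S.
  move=> iF.
  have eF : val @: [set A : token2_vertex G | val A \in F] = F.
    apply/setP => B; apply/imsetP/idP => [[A]|BF]; first by rewrite inE => ? ->.
    have /eqP B2 := iF.1 _ BF.
    by exists (Sub B B2); rewrite ?inE SubK.
  have /maxset_exists [S maxS sS] : independent
      ([set A | val A \in F] : {set token2 G}) by apply/independent_token2P; rewrite eF.
  by exists S => //; rewrite -eF; apply: imsetS.
have [S0 max0 s0] := lift _ i0; have [S1 max1 s1] := lift _ i1.
apply: leq_trans (subset_leq_card s1) _.
have inj_val (S : {set token2 G}) : #|val @: S| = #|S| by apply: card_imset; apply: val_inj.
rewrite inj_val (wc _ _ max1 max0) -inj_val; apply: le_k s0.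
exact/independent_token2P/(maxsetp max0).
Qed.

(** * Upper bounds for independent families *)

(** Two distinct pairs sharing a vertex would have distinct other ends in [C], hence adjacent
    ones. *)
Lemma token_independent_clique (G : sgraph) (C : {set G}) (F : {set {set G}}) :
  clique C -> token_independent F ->
  matching_on C [set B in F | B \subset C].
Proof.
move=> clC [F2 iF]; split=> [B|]; first by rewrite inE => /andP[/F2 -> ->].
apply/trivIsetP => A B; rewrite !inE => /andP[AF AC] /andP[BF BC] nAB.
rewrite -setI_eq0; apply: contraNT nAB => /set0Pn [w].
rewrite inE => /andP[wA wB].
have [a _ eA] := set2_of_mem (F2 _ AF) wA; have [b _ eB] := set2_of_mem (F2 _ BF) wB.
rewrite eA eB in AF BF AC BC *.
have [-> //|ab] := eqVneq a b.
have := iF _ _ _ AF BF; rewrite clC //.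
  by apply: (subsetP AC); rewrite !inE eqxx orbT.
by apply: (subsetP BC); rewrite !inE eqxx orbT.
Qed.

(** A vertex of [X] lies in at most one crossing pair, because the other ends lie in the clique [Y].
    So [B] is determined by its trace on [X], a singleton. *)
Lemma card_transversal_leq (G : sgraph) (X Y : {set G}) (F : {set {set G}}) :
  two_clique_graph X Y -> token_independent F ->
  #|[set B in F | ~~ (B \subset X) && ~~ (B \subset Y)]| <= #|X|.
Proof.
move=> [XY dXY clX clY _] [F2 iF]; set T := [set B in F | _].
have inXY c : (c \in X) || (c \in Y) by rewrite -in_setU XY inE.
have TP B : B \in T -> exists2 x, x \in X & exists2 y, y \in Y & B = [set x; y].
  rewrite inE => /and3P[/F2 B2 /subsetPn [y yB yX] /subsetPn [x xB xY]].
  exists x; first by move: (inXY x); rewrite (negPf xY) orbF.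
  exists y; first by move: (inXY y); rewrite (negPf yX).
  have [u _ eB] := set2_of_mem B2 xB; move: yB; rewrite eB !inE => /orP[] /eqP yE.
    by move: (inXY x); rewrite (negPf xY) -yE (negPf yX).
  by rewrite yE.
pose f (B : {set G}) := [set x in B | x \in X].
have fE x y : x \in X -> y \in Y -> f [set x; y] = [set x].
  move=> xX yY; apply/setP => c; rewrite !inE.
  have [->|cx] := eqVneq c x; first by rewrite xX.
  have [->|//] := eqVneq c y; by rewrite (disjointFl dXY yY).
have injf : {in T &, injective f}.
  move=> A B AT BT; have := AT; have := BT; rewrite !inE => /andP[BF _] /andP[AF _].
  have [x xX [y yY eA]] := TP _ AT; have [x' xX' [y' yY' eB]] := TP _ BT.
  rewrite eA eB !fE // => /set1_inj exx; rewrite -exx in eB *.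
  have [-> //|yy] := eqVneq y y'.
  by have := iF x y y'; rewrite -eA -eB => /(_ AF BF); rewrite clY.
rewrite -(card_in_imset injf) -(card_imset X (@set1_inj G)).
apply/subset_leq_card/subsetP => C /imsetP [B BT ->].
by have [x xX [y yY ->]] := TP _ BT; rewrite fE ?imset_f.
Qed.

(* The pairs [{h y, y}] forbid every pair inside [W], so once [Y :\: W] is
   perfectly matched no further pair of [Y] can be added. *)
Lemma exists_blocking_family (G : sgraph) (X Y W D : {set G}) (h : G -> G) :
  two_clique_graph X Y -> W \subset Y -> ~~ odd #|Y :\: W| -> D \subset W ->
  {in D, forall y, h y \in X} -> {in D &, injective h} ->
  {in W &, forall y y', y != y' ->
     (y \in D) && adj (h y) y' || (y' \in D) && adj (h y') y} ->
  exists2 F0 : {set {set G}}, token_independent F0 &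
    forall F, token_independent F -> F0 \subset F ->
      #|F| <= #|X|./2 + #|X| + #|Y :\: W|./2.
Proof.
move=> hG WY evW DW hX injh block; have [XY dXY clX clY _] := hG.
have [M hM cM] := exists_matching (Y :\: W).
have XnY c : c \in X -> c \in Y = false by move=> cX; rewrite (disjointFr dXY cX).
pose A := [set [set h y; y] | y in D].
have AP w a : [set w; a] \in A ->
    (w \in D /\ a = h w) \/ (a \in D /\ w = h a).
  move=> /imsetP [y yD e].
  have ny : h y != y.
    apply: contraTneq (hX _ yD) => ->.
    by rewrite (disjointFl dXY) // (subsetP WY) // (subsetP DW).
  have /set2P [ey|ey] : y \in [set w; a] by rewrite e set22.
    left; split; first by rewrite -ey.
    have /set2P [eh|<-] : h y \in [set w; a] by rewrite e set21.
      by rewrite eh ey eqxx in ny.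
    by rewrite -ey.
  right; split; first by rewrite -ey.
  have /set2P [<-|eh] : h y \in [set w; a] by rewrite e set21.
    by rewrite -ey.
  by rewrite eh ey eqxx in ny.
have DY y : y \in D -> y \in Y by move=> yD; apply: (subsetP WY); apply: (subsetP DW).
have Mmem w a : [set w; a] \in M -> (w \in Y :\: W) * (a \in Y :\: W).
  move=> /hM.1 [/subsetP s _]; by rewrite !s ?set21 ?set22.
have M2 : {in M, forall B : {set G}, #|B| = 2} by move=> B /hM.1 [].
(* Pairs of [A] meet [Y] only in [D], inside [W], while pairs of [M] avoid both [W] and [X]. *)
have AM w a b : [set w; a] \in A -> [set w; b] \in M -> False.
  move=> /AP [] [yD e] /Mmem [wYW _]; move: wYW; rewrite inE => /andP[wW wY].
    by move: wW; rewrite (subsetP DW).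
  by move: wY; rewrite e XnY ?hX.
exists (A :|: M).
  split=> [B|w a b].
    rewrite inE => /orP[/imsetP [y yD ->]|/M2 //].
    rewrite cards2; suff -> : h y != y by [].
    by apply: contraTneq (hX _ yD) => ->; apply/negP => /XnY; rewrite DY.
  rewrite !inE => /orP[] wa /orP[] wb; 
    try by [have := AM _ _ _ wa wb | have := AM _ _ _ wb wa].
    suff -> : a = b by rewrite adj_irr.
    have [[wD ea]|[aD ea]] := AP _ _ wa; have [[wD' eb]|[bD eb]] := AP _ _ wb.
    - by rewrite ea eb.
    - by have := XnY _ (hX _ bD); rewrite -eb DY.
    - by have := XnY _ (hX _ aD); rewrite -ea DY.
    - by apply: injh => //; rewrite -ea -eb.
  by rewrite (matching_eq M2 hM.2 wa wb) adj_irr.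
move=> F iF sF.
have cX := card_cover_matching (token_independent_clique clX iF).
have leX : #|[set B in F | B \subset X]| <= #|X|./2.
  by have := subset_leq_card cX.1; rewrite cX.2; lia.
have leT := card_transversal_leq hG iF.
have [_ tFY] := token_independent_clique clY iF.
(* By parity [M] covers all of [Y :\: W]. A pair of [F] in [Y] that leaves [W] therefore meets a
   pair of [M], and equals it since the pairs of [F] in [Y] are disjoint. *)
have sub : [set B in F | B \subset Y] \subset M.
  apply/subsetP => B BFY; have := BFY; rewrite inE => /andP[BF BY].
  have MF C : C \in M -> C \in [set B in F | B \subset Y].
    move=> CM; rewrite inE (subsetP sF) ?inE ?CM ?orbT //=.
    by have [sC _] := hM.1 _ CM; apply: subset_trans sC (subsetDl _ _).
  have covM : cover M = Y :\: W.
    have [s c] := card_cover_matching hM.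
    by apply/eqP; rewrite eqEcard s c cM muln2 (even_halfK evW) leqnn.
  have [BW|] := boolP (B \subset W); last first.
    move=> /subsetPn [w wB wW]; have : w \in cover M.
      by rewrite covM inE wW (subsetP BY).
    move=> /bigcupP [C CM wC]; suff -> : B = C by [].
    apply/eqP; apply: contraT => nBC.
    have /pred0P /(_ w) := trivIsetP tFY _ _ BFY (MF _ CM) nBC.
    by rewrite /= wB wC.
  have B2 := iF.1 _ BF; have /eqP /cards2P [y [y' [nyy eB]]] := B2.
  have yW : y \in W by rewrite (subsetP BW) // eB set21.
  have yW' : y' \in W by rewrite (subsetP BW) // eB set22.
  have AF u : u \in D -> [set u; h u] \in F.
    move=> uD; rewrite (subsetP sF) // inE; apply/orP; left.
    by apply/imsetP; exists u => //; rewrite setUC.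
  rewrite eB in BF; have BF' : [set y'; y] \in F by rewrite setUC.
  (* The pairs {y, y'} and {y, h y} share [y], and [h y] is adjacent to [y']; or the same with [y]
     and [y'] exchanged. *)
  case/orP: (block _ _ yW yW' nyy) => /andP[uD ad].
    by have := iF.2 _ _ _ (AF _ uD) BF; rewrite ad.
  by have := iF.2 _ _ _ (AF _ uD) BF'; rewrite ad.
have leY := subset_leq_card sub; rewrite cM in leY.
have sFU : F \subset [set B in F | B \subset X]
    :|: [set B in F | ~~ (B \subset X) && ~~ (B \subset Y)]
    :|: [set B in F | B \subset Y].
  apply/subsetP => B BF; rewrite !inE BF /=.
  by case: (B \subset X); case: (B \subset Y).
apply: leq_trans (subset_leq_card sFU) _.
apply: leq_trans (leq_card_setU _ _) _; apply: leq_add => //.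
by apply: leq_trans (leq_card_setU _ _) _; apply: leq_add.
Qed.

(** * The large independent family *)

(** Take a maximum matching of [X], the pairs {x, f x}, and [M]. Conflicts can arise only at [x],
    excluded by the non-adjacency of [X] and its image, or at [f x], excluded by the last
    hypothesis. *)
Lemma exists_large_family (G : sgraph) (X Y : {set G}) (f : G -> G) (M : {set {set G}}) :
  two_clique_graph X Y -> {in X &, injective f} -> {in X, forall x, f x \in Y} ->
  {in X &, forall x x', ~~ adj x (f x')} -> matching_on Y M ->
  {in X, forall x b, [set f x; b] \in M -> ~~ adj x b} ->
  exists2 F : {set {set G}}, token_independent F & #|F| = #|X|./2 + #|X| + #|M|.
Proof.
move=> [_ dXY _ _ _] injf fY nadj [M2 tM] compat.
have [MX [MX2 tMX] cMX] := exists_matching X.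
have XnY c : c \in X -> c \in Y = false by move=> cX; rewrite (disjointFr dXY cX).
have nf x : x \in X -> x != f x.
  by move=> xX; apply: contraTneq (fY _ xX) => <-; rewrite XnY.
pose T := [set [set x; f x] | x in X].
have TP w a : [set w; a] \in T -> (w \in X /\ a = f w) \/ (a \in X /\ w = f a).
  move=> /imsetP [y yX e]; have ny := nf _ yX.
  have /set2P [ey|ey] : y \in [set w; a] by rewrite e set21.
    left; split; first by rewrite -ey.
    have /set2P [ef|<-] : f y \in [set w; a] by rewrite e set22.
      by rewrite ef ey eqxx in ny.
    by rewrite -ey.
  right; split; first by rewrite -ey.
  have /set2P [<-|ef] : f y \in [set w; a] by rewrite e set22.
    by rewrite -ey.
  by rewrite ef ey eqxx in ny.
have XP w a : [set w; a] \in MX -> (w \in X) * (a \in X).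
  by move=> /MX2 [/subsetP s _]; rewrite !s ?set21 ?set22.
have YP w a : [set w; a] \in M -> (w \in Y) * (a \in Y).
  by move=> /M2 [/subsetP s _]; rewrite !s ?set21 ?set22.
have cMX2 : {in MX, forall B : {set G}, #|B| = 2} by move=> B /MX2 [].
have cM2 : {in M, forall B : {set G}, #|B| = 2} by move=> B /M2 [].
have cT2 : {in T, forall B : {set G}, #|B| = 2}.
  by move=> B /imsetP [x xX ->]; rewrite cards2 nf.
have Tadj w a b : [set w; a] \in T -> [set w; b] \in T -> a = b.
  move=> /TP [] [wX ea] /TP [] [bX eb]; rewrite ?ea ?eb //.
  - by have := XnY _ wX; rewrite eb fY.
  - by have := XnY _ bX; rewrite ea fY.
  - by apply: injf => //; rewrite -ea -eb.
have XT w a b : [set w; a] \in MX -> [set w; b] \in T -> ~~ adj a b.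
  move=> /XP [wX aX] /TP [] [bX eb]; first by rewrite eb nadj.
  by have := XnY _ wX; rewrite eb fY.
have TM w a b : [set w; a] \in T -> [set w; b] \in M -> ~~ adj a b.
  move=> /TP [] [aX ea] wb; first by have := XnY _ aX; rewrite (YP _ _ wb).
  by apply: compat; rewrite -?ea.
exists (MX :|: T :|: M).
  split=> [B|w a b].
    by rewrite !inE -orbA => /or3P[/cMX2|/cT2|/cM2].
  have XM u c d : [set u; c] \in MX -> [set u; d] \in M -> False.
    by move=> /XP [uX _] /YP [uY _]; have := XnY _ uX; rewrite uY.
  rewrite !inE -!orbA => /or3P[] wa /or3P[] wb.
  - by rewrite (matching_eq cMX2 tMX wa wb) adj_irr.
  - exact: XT wa wb.
  - by case: (XM _ _ _ wa wb).
  - by rewrite adj_sym; apply: XT wb wa.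
  - by rewrite (Tadj _ _ _ wa wb) adj_irr.
  - exact: TM wa wb.
  - by case: (XM _ _ _ wb wa).
  - by rewrite adj_sym; apply: TM wb wa.
  - by rewrite (matching_eq cM2 tM wa wb) adj_irr.
have cT : #|T| = #|X|.
  apply: card_in_imset => x x' xX xX' /setP /(_ x).
  rewrite !inE eqxx => /esym /orP[/eqP //|/eqP e].
  by have := XnY _ xX; rewrite e fY.
have dXT : MX :&: T = set0.
  apply/setP => B; rewrite !inE; apply/negP => /andP[BX /imsetP [x xX e]].
  by rewrite e in BX; have [_ /XnY] := XP _ _ BX; rewrite fY.
have dXTM : (MX :|: T) :&: M = set0.
  apply/setP => B; rewrite !inE; apply/negP => /andP[BXT BM].
  have /eqP /cards2P [u [v [_ eB]]] := cM2 _ BM.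
  rewrite eB in BXT BM; have [uY vY] := YP _ _ BM.
  case/orP: BXT => [/XP [/XnY]|/TP [] [/XnY]]; by rewrite ?uY ?vY.
by rewrite cardsU dXTM cards0 subn0 cardsU dXT cards0 subn0 cT cMX.
Qed.

(** * Choice of [W] and contradiction *)

Theorem theorem6p7 (G : sgraph) (X Y : {set G}) (m n : nat)
  (hG : two_clique_graph X Y) (hm : #|X| = m) (hn : #|Y| = n)
  (hmn : m + 2 <= n)
  (x1 x2 y1 y2 : G)
  (hx1 : x1 \in X) (hx2 : x2 \in X) (hx : x1 != x2)
  (hy1 : y1 \in Y) (hy2 : y2 \in Y) (hy : y1 != y2)
  (h11 : adj x1 y1) (h12 : adj x1 y2) (h22 : adj x2 y2)
  (hN : #|[set y in Y | [exists x in X, adj x y]]| <= n - m) :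
  ~ well_covered (token2 G).
Proof.
move=> wc.
(* [N] has at most n - m elements, so [Z] has at least m and can receive [X] injectively. *)
set N := [set y in Y | _] in hN; pose Z := Y :\: N.
have NY : N \subset Y by apply/subsetP => y; rewrite inE => /andP[].
have ZY : Z \subset Y by apply: subsetDl.
have cZN : #|Z| + #|N| = n by rewrite -hn -(cardsID N Y) (setIidPr NY) addnC.
have inN x y : x \in X -> y \in Y -> adj x y -> y \in N.
  by move=> xX yY xy; rewrite inE yY; apply/exists_inP; exists x.
have nadjZ x z : x \in X -> z \in Z -> ~~ adj x z.
  move=> xX; rewrite inE => /andP[zN zY]; apply: contra zN; exact: inN.
have y1N : y1 \in N by apply: inN h11.
have y2N : y2 \in N by apply: inN h12.
have m2 : 1 < m by rewrite -hm; apply/card_gt1P; exists x1, x2.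
have dZN : [disjoint Z & N] by rewrite -setI_eq0 /Z setDE -setIA [~: N :&: N]setIC setICr setI0.
have ZN z : z \in Z -> z \in N = false by move=> zZ; rewrite (disjointFr dZN zZ).
have cYW (W : {set G}) : W \subset Y -> #|Y :\: W| = n - #|W|.
  by move=> WY; rewrite cardsD (setIidPr WY) hn.
have [|f injf fZ] := @exists_injection _ X Z; first by rewrite hm; clear -cZN hN hmn; lia.
have fY : {in X, forall x, f x \in Y} by move=> x xX; apply: (subsetP ZY); apply: fZ.
have nadjf : {in X &, forall x x', ~~ adj x (f x')}.
  by move=> x x' xX xX'; apply: nadjZ; rewrite ?fZ.
(* The blocking family and the large family share the terms from [X] and the crossing pairs; only
   the pairs inside [Y] remain to be compared. *)
have contraM (W D : {set G}) h M : W \subset Y -> ~~ odd (n - #|W|) -> D \subset W ->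
    {in D, forall y, h y \in X} -> {in D &, injective h} ->
    {in W &, forall y y', y != y' ->
       (y \in D) && adj (h y) y' || (y' \in D) && adj (h y') y} ->
    matching_on Y M ->
    {in X, forall x b, [set f x; b] \in M -> ~~ adj x b} ->
    #|M| <= (n - #|W|)./2.
  move=> WY oW DW hX injh block hM compat.
  have [|F0 i0 le0] := exists_blocking_family hG WY _ DW hX injh block; first by rewrite cYW.
  have [F1 i1 c1] := exists_large_family hG injf fY nadjf hM compat.
  have := well_covered_token2_leq wc i0 i1 le0.
  by rewrite c1 cYW // leq_add2l.
(* For n even, {x1, y2} alone blocks {y1, y2}, as [x1] is adjacent to [y1]. So no admissible [M] is
   a perfect matching of [Y]. *)
have W2 M : ~~ odd n -> matching_on Y M ->
    {in X, forall x b, [set f x; b] \in M -> ~~ adj x b} -> #|M| <= (n - 2)./2.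
  move=> on hM compat; have c2 : #|[set y1; y2]| = 2 by rewrite cards2 hy.
  rewrite -c2; apply: (contraM _ [set y2] (fun=> x1)) => //.
  - by apply/subsetP => y /set2P [] ->.
  - by rewrite c2; clear -on hmn; lia.
  - by rewrite sub1set set22.
  - by move=> y y' /set1P -> /set1P ->.
  - move=> y y' /set2P [] -> /set2P [] ->; rewrite !inE ?eqxx ?(negPf hy) //= ?h11 ?orbT //.
have [MZ hMZ cMZ] := exists_matching Z; have [MN hMN cMN] := exists_matching N.
have [hM cM] := matching_on_setU hMZ hMN dZN.
have UZN : Z :|: N = Y by rewrite setUC -[RHS](setID Y N) (setIidPr NY).
rewrite UZN in hM.
(* If no pair mixes [Z] and [N], the partner of [f x] lies in [Z] and has no neighbour in [X]. *)
have compatM (A : {set G}) : A \subset Z -> forall MA, matching_on A MA ->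
    forall (B : {set G}) MB, B \subset N -> matching_on B MB ->
    {in X, forall x b, [set f x; b] \in MA :|: MB -> ~~ adj x b}.
  move=> AZ MA hA B MB BN hB x xX b; rewrite inE => /orP[/hA.1|/hB.1] [/subsetP s _].
    by apply: nadjZ => //; apply: (subsetP AZ); rewrite s ?set22.
  by have := subsetP BN _ (s _ (set21 _ _)); rewrite ZN ?fZ.
have compat0 := compatM _ (subxx _) _ hMZ _ _ (subxx _) hMN.
have [on|on] := boolP (odd n).
  have [z zZ] : exists z, z \in Z by apply/card_gt0P; clear -cZN hN hmn m2; lia.
  have zy1 : y1 != z by apply: contraTneq y1N => ->; rewrite ZN.
  have zy2 : y2 != z by apply: contraTneq y2N => ->; rewrite ZN.
  have c3 : #|z |: [set y1; y2]| = 3.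
    by rewrite cardsU1 !inE cards2 hy !(eq_sym z) (negPf zy1) (negPf zy2).
  (* {x1, z} blocks the pairs of [z] with [y1] and [y2]; {x2, y1} blocks {y1, y2}. As n is odd, one
     of |Z|, |N| is even, so [MZ] and [MN] together have (n - 1)/2 pairs, too many. *)
  have := contraM (z |: [set y1; y2]) [set z; y1] (fun y => if y == z then x1 else x2) _
    _ _ _ _ _ _ hM compat0.
  rewrite c3 cM cMZ cMN => le3; suff : #|Z|./2 + #|N|./2 <= (n - 3)./2.
    by clear -cZN on hmn m2; lia.
  apply: le3.
  - by apply/subsetP => y; rewrite !inE => /or3P[] /eqP -> //; apply: (subsetP ZY).
  - by clear -on hmn m2; lia.
  - by apply/subsetP => y; rewrite !inE => /orP[] ->; rewrite ?orbT.
  - by move=> y _; case: ifP.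
  - move=> y y' /set2P [] -> /set2P [] ->; rewrite ?eqxx ?(negPf zy1) // => e;
      by rewrite e eqxx in hx.
  - move=> y y'; rewrite !inE => /or3P[] /eqP -> /or3P[] /eqP ->;
      rewrite ?eqxx ?(negPf zy1) ?(negPf zy2) ?(eq_sym z) ?(negPf zy1) ?(negPf zy2)
        ?(negPf hy) ?(eq_sym y2) ?(negPf hy) ?h11 ?h12 ?h22 ?orbT //.
have := W2 _ on hM compat0; rewrite cM cMZ cMN => le2.
(* If |Z| and |N| were even, [MZ] and [MN] would match [Y] perfectly. *)
have oZ : odd #|Z| by clear -le2 cZN on hmn; lia.
(* With |Z| and |N| odd, one mixed pair {z, y} completes a perfect matching of [Y]; it is admissible
   unless z = f x for a neighbour x of [y]. *)
have mixed z y : z \in Z -> y \in N -> {in X, forall x, f x = z -> ~~ adj x y} -> False.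
  move=> zZ yN zy; have [MZ' hMZ' cMZ'] := exists_matching (Z :\ z).
  have [MN' hMN' cMN'] := exists_matching (N :\ y).
  have zny : z != y by apply: contraTneq yN => <-; rewrite ZN.
  have [|hU cU] := matching_on_setU hMZ' hMN'.
    exact: disjointWl (subsetDl _ _) (disjointWr (subsetDl _ _) dZN).
  have [|hV cV] := matching_on_setU hU (matching_on_pair zny).
    apply/pred0P => c /=; rewrite in_setU !in_setD1 in_set2.
    have [->|_] := eqVneq c z; first by rewrite (negPf zny) ZN.
    by have [->|_] := eqVneq c y; rewrite ?(disjointFl dZN yN) ?andbF.
  have eV : (Z :\ z) :|: (N :\ y) :|: [set z; y] = Y.
    by rewrite setUACA ![_ :\ _ :|: _]setUC !setD1K.
  rewrite eV in hV.
  have := W2 _ on hV; rewrite cV cU cMZ' cMN' cards1.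
  have := cardsD1 z Z; have := cardsD1 y N; rewrite zZ yN => e1 e2 le.
  suff : (#|Z :\ z|)./2 + (#|N :\ y|)./2 + 1 <= (n - 2)./2.
    by clear -e1 e2 cZN on oZ hmn; lia.
  apply: le => x xX b; rewrite inE => /orP[].
    exact: (compatM _ (subsetDl _ _) _ hMZ' _ _ (subsetDl _ _) hMN').
  move=> /set1P e; have : f x \in [set z; y] by rewrite -e set21.
  have : b \in [set z; y] by rewrite -e set22.
  move=> /set2P [] ->; first by rewrite nadjZ.
  move=> /set2P [/(zy _ xX) //|ef].
  by have := ZN _ (fZ _ xX); rewrite ef yN.
have cfX : #|f @: X| = m by rewrite card_in_imset.
(* A [z] outside the image of [f] satisfies the condition of [mixed] vacuously. Otherwise |Z| = m
   and, as [f] is injective, [mixed] at [f x] forces x to be joined to all of [N]. *)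
have [ltZ|leZ] := ltnP m #|Z|.
  have [z zZ zf] : exists2 z, z \in Z & z \notin f @: X.
    apply/subsetPn; apply: contraL ltZ => /subset_leq_card; by rewrite cfX -leqNgt.
  apply: (mixed z y1 zZ y1N) => x xX e; by rewrite -e imset_f in zf.
have joined x y : x \in X -> y \in N -> adj x y.
  move=> xX yN; apply: contraT => nxy; exfalso.
  by apply: (mixed (f x) y (fZ _ xX) yN) => x' xX' /injf ->.
(* Here m = |Z| is odd and at least 2, hence at least 3. *)
have [x3 x3X] : exists2 x, x \in X & x \notin [set x1; x2].
  apply/subsetPn/negP => /subset_leq_card; rewrite cards2 hx hm.
  by clear -m2 oZ leZ cZN hN hmn; lia.
rewrite !inE negb_or => /andP[x31 x32].
(* Likewise |N| = n - |Z| is odd and at least 2. *)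
have [y3 y3N] : exists2 y, y \in N & y \notin [set y1; y2].
  apply/subsetPn/negP => /subset_leq_card; rewrite cards2 hy => c2.
  have : 1 < #|N| by apply/card_gt1P; exists y1, y2.
  by clear -c2 cZN on oZ; lia.
rewrite !inE negb_or => /andP[y31 y32].
have zZ := fZ _ hx1; set z := f x1 in zZ.
have Nnz y : y \in N -> y != z by move=> yN; apply: contraTneq yN => ->; rewrite ZN.
have c4 : #|z |: (y3 |: [set y1; y2])| = 4.
  by rewrite !cardsU1 !inE cards1 !(eq_sym z) !(negPf (Nnz _ _)) // (negPf y31) (negPf y32) (negPf hy).
(* [z], [y1], [y2] get the distinct partners [x1], [x2], [x3]. Of two distinct elements of W = {z,
   y3, y1, y2}, one lies in D = {z, y1, y2} and the other in [N], to which all of [X] is joined. *)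
pose h y := if y == z then x1 else if y == y1 then x2 else x3.
have hX y : h y \in X by rewrite /h; do 2!case: ifP => // _.
have := contraM (z |: (y3 |: [set y1; y2])) (z |: [set y1; y2]) h _
  _ _ _ _ _ _ hM compat0.
(* As |Z| and |N| are odd, the left side is (n - 2)/2. The bound |N| > 2 gives n >= 4, so that n - 4
   is not truncated. *)
rewrite c4 cM cMZ cMN => le4; suff : #|Z|./2 + #|N|./2 <= (n - 4)./2.
  have : 2 < #|N|.
    by apply/card_gt2P; exists y1, y2, y3; split; split; rewrite // eq_sym.
  by clear -cZN on oZ; lia.
apply: le4.
- apply/subsetP => y; rewrite !inE => /or4P[] /eqP -> //.
    exact: (subsetP ZY).
  exact: (subsetP NY).
- by clear -on hmn m2; lia.
- by apply/subsetP => y; rewrite !inE => /or3P[] ->; rewrite ?orbT.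
- by [].
- move=> y y'; rewrite /h !inE => /or3P[] /eqP -> /or3P[] /eqP ->;
    rewrite ?eqxx ?(negPf (Nnz _ y1N)) ?(negPf (Nnz _ y2N)) ?(eq_sym y2) ?(negPf hy) // => e;
    by rewrite e eqxx in hx x31 x32.
- move=> y y' yW yW' nyy.
  have WP u : u \in z |: (y3 |: [set y1; y2]) -> u = z \/ u \in N.
    by move=> /setU1P [->|/setU1P [->|/set2P [] ->]]; auto.
  case: (WP y yW) => [ey|yN]; case: (WP y' yW') => [ey'|yN'].
  + by rewrite ey ey' eqxx in nyy.
  + by rewrite ey !inE eqxx joined.
  + by apply/orP; right; rewrite ey' joined // !inE eqxx.
  + rewrite !joined // !andbT; move: yW yW'; rewrite !inE.
    have [_|_] := eqVneq y z; first by [].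
    have [_|_] := eqVneq y' z; first by rewrite orbT.
    have [ey|_] := eqVneq y y3 => /=; last by move=> ->.
    have [ey'|_] := eqVneq y' y3 => /=; last by move=> _ ->; rewrite orbT.
    by rewrite ey ey' eqxx in nyy.
Qed.
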